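(* Let $(G,B,m,w)$ be a connected finite graph with boundary equipped with a normalized weight such that $E(B,B)=\emptyset$ (no edge joins two boundary vertices). Then $\nu_i=\mu_i$ for all $i=1,2,\dots,|\Omega|$ if and only if (1) for any $x\in B$ and $y\in\Omega$, $w_{xy}=\frac{1}{V_\Omega}m_xm_y$, and (2) $\mu_{|\Omega|}(\Omega)\le\frac{V_\Omega-V_B}{V_\Omega}$ when $|B|\ge2$, and $\mu_{|\Omega|}(\Omega)\le1$ when $|B|=1$. Here $V_B=\sum_{x\in B}m_x$ and $V_\Omega=\sum_{y\in\Omega}m_y$.
   Context: A weighted finite graph $(G,m,w)$ is a finite simple graph $G$ with vertex set $V$ and edge set $E$, a vertex-measure $m:V\to(0,\infty)$ and an edge-weight $w:E\to(0,\infty)$; $w$ is extended to a symmetric function on $V\times V$ by $w_{xy}=0$ when $\{x,y\}\notin E$. The weight is normalized if $\operatorname{Deg}(x):=\frac1{m_x}\sum_{y\in V}w_{xy}=1$ for every $x\in V$. A weighted finite graph with boundary $(G,B,m,w)$ is a weighted finite graph with a nonempty subset $B\subset V$ (the boundary); $\Omega=V\setminus B$ is the interior. $\mathbb{R}^S$ is the space of real functions on $S$, with inner product $\langle u,v\rangle_S=\sum_{x\in S}u(x)v(x)m_x$. Laplacian: $\Delta u(x)=\frac1{m_x}\sum_{y\in V}(u(x)-u(y))w_{xy}$ for $u\in\mathbb{R}^V$; its eigenvalues, counted with multiplicity, are $0=\mu_1\le\mu_2\le\dots\le\mu_{|V|}$. For nonempty $S\subset V$, $0=\mu_1(S)\le\dots\le\mu_{|S|}(S)$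 are the eigenvalues of the Laplacian $\Delta_Su(x)=\frac1{m_x}\sum_{y\in S}(u(x)-u(y))w_{xy}$ on $\mathbb{R}^S$ of the induced subgraph on $S$ (inheriting $m$ and $w$). Neumann Laplacian: for $u\in\mathbb{R}^\Omega$, let $N_0(u)\in\mathbb{R}^V$ be the unique function with $N_0(u)=u$ on $\Omega$ and $\Delta N_0(u)=0$ on $B$. Set $\Delta^N u=(\Delta N_0(u))|_\Omega$, a nonnegative self-adjoint operator on $\mathbb{R}^\Omega$, with eigenvalues (the Neumann eigenvalues), counted with multiplicity, $0\le\nu_1\le\nu_2\le\dots\le\nu_{|\Omega|}$. *)

(* Defs.v *)
From HB Require Import structures.
From mathcomp Require Import all_boot all_order all_algebra.
From mathcomp Require Import polyrcf.
From mathcomp Require Import boolp classical_sets reals.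

Set Implicit Arguments.
Unset Strict Implicit.
Unset Printing Implicit Defensive.

Import Order.TTheory GRing.Theory Num.Theory.
Local Open Scope ring_scope.

(* [ew] is the edge-weight already extended by zero to all pairs. *)
Record wgraph (R : realType) (V : finType) := WGraph {
  adj : rel V;
  vm : V -> R;
  ew : V -> V -> R;
  adj_sym : symmetric adj;
  adj_irr : irreflexive adj;
  vm_gt0 : forall x, 0 < vm x;
  ew_sym : forall x y, ew x y = ew y x;
  ew_gt0 : forall x y, adj x y -> 0 < ew x y;
  ew_eq0 : forall x y, ~~ adj x y -> ew x y = 0
}.

Section Graph.
Context {R : realType} {V : finType}.
Implicit Types (G : wgraph R V) (S B : {set V}).

Definition connected_graph G := forall x y : V, connect (adj G) x y.

Definition Deg G (x : V) : R := (vm G x)^-1 * \sum_(y : V) ew G x y.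

Definition normalized G := forall x, Deg G x = 1.

Definition volume G S : R := \sum_(x in S) vm G x.

Definition laplacian G (u : {ffun V -> R}) : {ffun V -> R} :=
  [ffun x => (vm G x)^-1 * \sum_(y : V) (u x - u y) * ew G x y].

Definition induced G S : wgraph R {x : V | x \in S} :=
  @WGraph R {x : V | x \in S}
    (fun x y => adj G (val x) (val y))
    (fun x => vm G (val x))
    (fun x y => ew G (val x) (val y))
    (fun x y => adj_sym G (val x) (val y))
    (fun x => adj_irr G (val x))
    (fun x => vm_gt0 G (val x))
    (fun x y => ew_sym G (val x) (val y))
    (fun x y => @ew_gt0 _ _ G (val x) (val y))
    (fun x y => @ew_eq0 _ _ G (val x) (val y)).

Definition is_neumann_ext G B (u : {ffun {x : V | x \in ~: B} -> R})
    (f : {ffun V -> R}) : Prop :=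
  (forall x : {x : V | x \in ~: B}, f (val x) = u x) /\
  (forall x, x \in B -> laplacian G f x = 0).

(* N_0(u). The extension exists and is unique as soon as every connected
   component of G meets ~: B; the default 0 is only used when there is none. *)
Definition neumann_ext G B (u : {ffun {x : V | x \in ~: B} -> R}) :
    {ffun V -> R} :=
  xget 0 [set f | is_neumann_ext G u f]%classic.

Definition neumann_laplacian G B (u : {ffun {x : V | x \in ~: B} -> R}) :
    {ffun {x : V | x \in ~: B} -> R} :=
  [ffun x => laplacian G (neumann_ext G u) (val x)].

End Graph.

Section Spectrum.
Context {R : realType} {T : finType}.
Implicit Types L : {ffun T -> R} -> {ffun T -> R}.

(* The matrix, acting on column vectors, of a linear operator on R^T in the
   basis of indicator functions of points. *)
Definition op_mx L : 'M[R]_#|T| :=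
  \matrix_(i, j) L [ffun y => (y == enum_val j)%:R] (enum_val i).

(* The real eigenvalues in nondecreasing order ([rootsR] is increasing), each
   repeated according to its algebraic multiplicity. For an operator that is
   self-adjoint for some inner product, this list has length #|T|. *)
Definition eigenvalues L : seq R :=
  let p := char_poly (op_mx L) in
  flatten [seq nseq (mup a p) a | a <- rootsR p].

(* Numbered from 1: [eigval L 1] is the smallest eigenvalue. *)
Definition eigval L (i : nat) : R := nth 0 (eigenvalues L) i.-1.

End Spectrum.

Section GraphEigenvalues.
Context {R : realType} {V : finType}.
Implicit Types (G : wgraph R V) (B : {set V}).

Definition mu G (i : nat) : R := eigval (laplacian G) i.

Definition nu G B (i : nat) : R := eigval (@neumann_laplacian R V G B) i.

End GraphEigenvalues.

(* Main.v *)
(* After conjugation by the square roots of the vertex measure, the normalized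
   Laplacian becomes 1 - P with P = [[A, C], [C^T, 0]], and the Neumann
   Laplacian becomes N = 1 - A - C C^T, because harmonic extension maps u to
   C^T u on the boundary.
   If the spectrum of N is the bottom of the spectrum of 1 - P, Ky Fan's trace
   principle on the range of the harmonic extension forces every eigenvector of
   C C^T with nonzero eigenvalue to have a constant extension, so C has rank
   one, which is (1). Conversely, under (1), with b = V_B / V_Omega, Schur
   complements give
     char(1 - P) = char(N) (X - 1 - b) (X - 1)^(|B| - 1)  and
     char(N) (X - b) = X char(Delta_Omega + b),
   so that nu_i = mu_i for all i <= |Omega| means that the largest nu does not
   exceed the least of the additional eigenvalues 1 + b and 1, which is (2). *)
Require Import Defs.
From mathcomp Require Import all_boot all_order all_algebra.
From mathcomp Require Import perm complex polyrcf ring.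
From mathcomp Require classical_sets.
From mathcomp Require Import reals.

Set Implicit Arguments.
Unset Strict Implicit.
Unset Printing Implicit Defensive.

Import Order.TTheory GRing.Theory Num.Theory.
Local Open Scope ring_scope.

(** * Spectral theorem for symmetric matrices over a real closed field *)

Section RealSpectral.
Context {R : rcfType}.

Lemma sqnorm_ge0 n (v : 'rV[R]_n) : 0 <= (v *m v^T) 0 0.
Proof. by rewrite mxE sumr_ge0 // => i _; rewrite mxE -expr2 sqr_ge0. Qed.

Lemma sqnorm_eq0 n (v : 'rV[R]_n) : ((v *m v^T) 0 0 == 0) = (v == 0).
Proof.
apply/eqP/eqP => [|->]; last by rewrite mul0mx mxE.
rewrite mxE => /eqP; rewrite psumr_eq0 => [/allP v0|i _]; last first.
  by rewrite mxE -expr2 sqr_ge0.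
apply/rowP => i; have := v0 i; rewrite mem_index_enum mxE -expr2 sqrf_eq0 mxE.
by move=> /(_ isT)/eqP.
Qed.


(** The complexified matrix is Hermitian, so the complex spectral theorem provides a real
    eigenvalue; being a root of the real characteristic polynomial, it has a real eigenvector, which
    is then normalized. *)
Lemma symmetric_eigenvector n (A : 'M[R]_n.+1) : A^T = A ->
  exists (a : R) (v : 'rV_n.+1), v *m A = a *: v /\ v *m v^T = 1%:M.
Proof.
move=> symA; pose AC := map_mx (real_complex R) A.
have hermA : AC \is hermsymmx.
  apply: realsym_hermsym.
    apply/is_hermitianmxP; rewrite expr0 scale1r map_mx_id //.
    by rewrite /AC map_trmx symA.
  by apply/mxOverP => i j; rewrite mxE complex_real.
have /orthomx_spectralP := hermitian_normalmx hermA.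
have /mxOverP/(_ 0 0)/complex_realP[a] := hermitian_spectral_diag_real hermA.
have := spectral_unit AC; set P := spectralmx AC; set d := spectral_diag AC.
move=> Pu d0 eqA.
have: eigenvalue AC (real_complex R a).
  apply/eigenvalueP; exists (row 0 P); last first.
    apply: contraTneq (Pu) => P0.
    rewrite unitmxE (expand_det_row _ 0) big1 ?unitr0 // => j _.
    by move/rowP: P0 => /(_ j); rewrite !mxE => ->; rewrite mul0r.
  by rewrite eqA -row_mul !mulmxA mulmxV // mul1mx row_mul row_diag_mx d0
    -scalemxAl -rowE.
rewrite eigenvalue_root_char -map_char_poly fmorph_root -eigenvalue_root_char.
move=> /eigenvalueP[v vA v_neq0].
have nv_gt0: 0 < (v *m v^T) 0 0 by rewrite lt_def sqnorm_eq0 v_neq0 sqnorm_ge0.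
pose c := (Num.sqrt ((v *m v^T) 0 0))^-1.
exists a, (c *: v); split; first by rewrite -scalemxAl vA !scalerA mulrC.
rewrite linearZ /= -scalemxAl -scalemxAr scalerA [v *m _]mx11_scalar -scalemx1.
by rewrite scalerA -expr2 exprVn sqr_sqrtr ?ltW // mulVf ?scale1r ?gt_eqF.
Qed.

(** The Householder reflection in the hyperplane orthogonal to ['e_0 - v] exchanges ['e_0] and [v].
    When [v = 'e_0] there is no such hyperplane and the identity serves. *)
Lemma orthogonal_with_row0 n (v : 'rV[R]_n.+1) : v *m v^T = 1%:M ->
  exists Q : 'M_n.+1, [/\ Q *m Q^T = 1%:M, Q^T *m Q = 1%:M & row 0 Q = v].
Proof.
move=> v1; have [->|v_neq] := eqVneq v 'e_0.
  by exists 1%:M; rewrite trmx1 mul1mx row1.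
pose e : 'rV[R]_n.+1 := 'e_0; have [w wdef] : exists w, w = e - v.
  by exists (e - v).
pose s := (w *m w^T) 0 0.
have s_gt0: s != 0 by rewrite sqnorm_eq0 wdef subr_eq0 eq_sym.
have ee: e *m e^T = 1%:M.
  by rewrite trmx_delta mul_delta_mx; apply/matrixP => i j; rewrite !ord1 !mxE.
have ve : v *m e^T = e *m v^T.
  by rewrite [LHS]mx11_scalar -tr_scalar_mx -mx11_scalar trmx_mul trmxK.
(* Both [e] and [v] are unit vectors; this identity makes the reflection subtract exactly [w] from
   [e]. *)
have wE: 2 *: (e *m w^T) = w *m w^T.
  rewrite wdef !(linearB, linearD) /= !(mulmxBl, mulmxBr).
  rewrite v1 ee ve.
  by rewrite opprB !scaler_nat !mulr2n opprD addrACA.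
have symQ : (1%:M - (2 / s) *: (w^T *m w))^T = 1%:M - (2 / s) *: (w^T *m w).
  by rewrite linearB linearZ /= trmx1 trmx_mul trmxK.
have QQ : (1%:M - (2 / s) *: (w^T *m w)) *m (1%:M - (2 / s) *: (w^T *m w)) =
  1%:M.
  have sq : (w^T *m w) *m (w^T *m w) = s *: (w^T *m w).
    by rewrite mulmxA -[_ *m w *m w^T]mulmxA [w *m _]mx11_scalar mul_mx_scalar
      scalemxAl.
  rewrite mulmxBl mul1mx mulmxBr mulmx1 -scalemxAl -scalemxAr sq !scalerA
    -mulrA divfK //.
  by rewrite mulr_natr mulr2n scalerDl opprB addrK subrK.
exists (1%:M - (2 / s) *: (w^T *m w)); rewrite symQ; split=> //.
rewrite rowE -/e mulmxBr mulmx1 -scalemxAr mulmxA mulrC -scalerA scalemxAl wE.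
by rewrite [w *m _]mx11_scalar mul_scalar_mx scalerA mulVf // scale1r wdef
  opprB addrC subrK.
Qed.

(** Induction on the size: conjugation by an orthogonal matrix whose first row is a unit eigenvector
    clears the first row off the diagonal, hence by symmetry the first column, and leaves a smaller
    symmetric block. *)
Theorem symmetric_spectral n (A : 'M[R]_n) : A^T = A ->
  exists (Q : 'M_n) (d : 'rV_n),
    [/\ Q *m Q^T = 1%:M, Q^T *m Q = 1%:M & A = Q^T *m diag_mx d *m Q].
Proof.
elim: n A => [|n IHn] A symA.
  by exists 1%:M, 0; split; apply/matrixP => [] [].
have [a [v [vA v1]]] := symmetric_eigenvector symA.
have [P [PPt PtP rowP0]] := orthogonal_with_row0 v1.
have [B BE'] : exists B : 'M_(1 + n), B = P *m A *m P^T.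
  by exists (P *m A *m P^T).
have symB : B^T = B by rewrite BE' !trmx_mul trmxK symA mulmxA.
have B0 j : B 0 j = if j == 0 then a else 0.
  have: row 0 B 0 j = B 0 j by rewrite mxE.
  move=> <-; rewrite BE' !row_mul rowP0 vA -scalemxAl -rowP0 -row_mul PPt.
  by rewrite !mxE eq_sym; case: eqP; rewrite ?mulr1 ?mulr0.
have l0 : lshift n (0 : 'I_1) = (0 : 'I_(1 + n)) by apply/val_inj.
have BE : B = block_mx a%:M 0 0 (drsubmx B).
  rewrite -{1}[B]submxK; congr block_mx.
  - by apply/matrixP => i j; rewrite !ord1 !mxE !l0 B0.
  - by apply/matrixP => i j; rewrite !ord1 !mxE !l0 B0 -val_eqE.
  - apply/matrixP => i j; rewrite !ord1 !mxE !l0 -[B]symB mxE B0.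
    by rewrite -val_eqE.
have [|U [d [UUt UtU dE]]] := IHn (drsubmx B); first by rewrite trmx_drsub symB.
pose W : 'M_(1 + n) := block_mx 1%:M 0 0 U.
have WWt : W *m W^T = 1%:M.
  by rewrite tr_block_mx mulmx_block !trmx0 trmx1
    !(mulmx0, mul0mx, addr0, add0r) mul1mx UUt -scalar_mx_block.
have WtW : W^T *m W = 1%:M.
  by rewrite tr_block_mx mulmx_block !trmx0 trmx1
    !(mulmx0, mul0mx, addr0, add0r) mul1mx UtU -scalar_mx_block.
exists ((W : 'M_n.+1) *m P), (row_mx a%:M d); split.
- by rewrite trmx_mul -mulmxA (mulmxA P) PPt mul1mx.
- by rewrite trmx_mul -mulmxA (mulmxA W^T) WtW mul1mx.
have -> : A = P^T *m B *m P.
  by rewrite BE' !mulmxA PtP mul1mx -mulmxA PtP mulmx1.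
suff -> : B = W^T *m diag_mx (row_mx a%:M d) *m W by rewrite trmx_mul !mulmxA.
rewrite {1}BE dE diag_mx_row tr_block_mx !mulmx_block !trmx0 trmx1
  !(mulmx0, mul0mx, addr0, add0r) mul1mx mulmx1.
by congr block_mx; apply/matrixP => i j; rewrite !ord1 !mxE.
Qed.
End RealSpectral.

(** * Eigenvalue lists and Ky Fan's trace principle *)

Section Spectra.
Context {R : realType}.

Lemma eigenvalues_sorted (T : finType) (L : {ffun T -> R} -> {ffun T -> R}) :
  sorted <=%R (eigenvalues L).
Proof.
rewrite /eigenvalues; set p := char_poly _.
have: sorted <%R (rootsR p) by apply: sorted_roots.
elim: (rootsR p) => //= a s IHs ps.
rewrite (sorted_pairwise le_trans) pairwise_cat -!(sorted_pairwise le_trans).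
rewrite IHs ?(path_sorted ps) // andbT; apply/andP; split; last first.
  rewrite (sorted_pairwise le_trans).
  by apply/(pairwiseP 0) => i j; rewrite !inE size_nseq !nth_nseq => -> ->.
apply/allrelP => x y /nseqP[-> _] /flattenP[_ /mapP[b bs ->]] /nseqP[-> _].
by move: ps; rewrite (path_sortedE lt_trans) => /andP[/allP/(_ _ bs)/ltW].
Qed.

(** Once the characteristic polynomial splits, its real roots taken with multiplicity exhaust the
    list of factors. *)
Lemma eigenvalues_perm (T : finType) (L : {ffun T -> R} -> {ffun T -> R}) d :
  char_poly (op_mx L) = \prod_(a <- d) ('X - a%:P) -> perm_eq (eigenvalues L) d.
Proof.
rewrite /eigenvalues => ->; set p := \prod_(a <- d) _.
have p_neq0 : p != 0 by rewrite monic_neq0 // monic_prod_XsubC.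
under eq_map do rewrite mu_prod_XsubC.
apply: perm_trans (perm_count_undup d); apply/perm_flatten/perm_map/uniq_perm.
- by apply: (sorted_uniq lt_trans ltxx); apply: sorted_roots.
- exact: undup_uniq.
- by move=> x; rewrite mem_undup -roots_on_rootsR // root_prod_XsubC.
Qed.

(** The enumeration [g] amounts to conjugation by a permutation, and [s] to a diagonal conjugation.
    With [s] the inverse square root of the vertex measure, the Laplacians become symmetric
    matrices. *)
Lemma char_poly_op_mx (T : finType) (L : {ffun T -> R} -> {ffun T -> R}) n
    (g : 'I_n -> T) (s : 'I_n -> R) (N : 'M[R]_n) :
    bijective g -> (forall i, s i != 0) ->
    (forall i j, L [ffun y => (y == g j)%:R] (g i) = s i * N i j / s j) ->
  char_poly (op_mx L) = char_poly N.
Proof.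
move=> bij_g s_neq0 LN.
have nT : n = #|T| by rewrite -(bij_eq_card bij_g) card_ord.
subst n.
have inj_h : injective (enum_rank \o g).
  by apply: inj_comp; [exact: enum_rank_inj | exact: bij_inj].
pose h := perm inj_h.
pose D := diag_mx (\row_j (s j)%:P).
rewrite /char_poly.
have detD : \det D != 0.
  rewrite det_diag; apply/prodf_neq0 => i _.
  by rewrite mxE polyC_eq0.
pose M := row_perm h (col_perm h (char_poly_mx (op_mx L))).
have <- : \det M = \det (char_poly_mx (op_mx L)).
  by rewrite /M row_permE col_permE !det_mulmx !det_perm odd_permV mulrCA mulrA
    -mulrA -expr2 sqrr_sign mulr1.
apply: (mulIf detD); rewrite [RHS]mulrC -!det_mulmx; congr (\det _).
apply/matrixP => i j; rewrite mul_mx_diag mul_diag_mx !mxE (inj_eq perm_inj).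
rewrite !permE /= !enum_rankK LN mulrBl mulrBr.
congr (_ - _); first by case: eqP => [->|_];
  rewrite ?mulr1n ?mulr0n ?mul0r ?mulr0 // mulrC.
by rewrite -!polyCM divfK.
Qed.

Lemma char_poly_conj n (P Q M : 'M[R]_n) : P *m Q = 1%:M ->
  char_poly (P *m M *m Q) = char_poly M.
Proof.
move=> PQ.
have PQX : map_mx polyC P *m map_mx polyC Q = 1%:M.
  by rewrite -map_mxM PQ map_mx1.
rewrite /char_poly; have -> : char_poly_mx (P *m M *m Q) =
    map_mx polyC P *m char_poly_mx M *m map_mx polyC Q.
  rewrite /char_poly_mx mulmxBr mulmxBl -!map_mxM; congr (_ - _).
  by rewrite mul_mx_scalar -scalemxAl PQX scalemx1.
by rewrite !det_mulmx mulrAC -det_mulmx PQX det1 mul1r.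
Qed.

(** [G^T *m G] is symmetric and idempotent, so its diagonal entry [p] is the squared norm of its row
    [j], hence at least [p ^+ 2]. *)
Lemma orthonormal_col_le1 n m (G : 'M[R]_(n, m)) : G *m G^T = 1%:M ->
  forall j, \sum_i G i j ^+ 2 <= 1.
Proof.
move=> GGt j; set p := \sum_i _.
have [P PE] : exists P, P = G^T *m G by exists (G^T *m G).
have PP : P *m P^T = P.
  by rewrite PE trmx_mul trmxK mulmxA -(mulmxA G^T) GGt mulmx1.
have Pjj : P j j = p by rewrite PE mxE; apply: eq_bigr => i _; rewrite mxE.
have : p ^+ 2 <= p.
  rewrite -{2}Pjj -PP mxE (bigD1 j) //= [P^T _ _]mxE Pjj expr2 lerDl.
  by apply: sumr_ge0 => k _; rewrite mxE -expr2 sqr_ge0.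
have [//|p1] := leP p 1.
by rewrite expr2 -{3}[p]mulr1 ler_pM2l ?(lt_trans ltr01) // leNgt p1.
Qed.

(* Ky Fan's principle: the weights of the rows of F on an eigenbasis of H lie in
   [0, 1] and add up to n, so the trace is least when they are concentrated on
   the n smallest eigenvalues. *)
Lemma sum_smallest_le_trace n m (H : 'M[R]_(n + m)) (F : 'M_(n, n + m))
    (t : seq R) :
    H^T = H -> F *m F^T = 1%:M -> sorted <=%R t ->
    char_poly H = \prod_(a <- t) ('X - a%:P) ->
  \sum_(i < n) t`_i <= \tr (F *m H *m F^T).
Proof.
move=> /symmetric_spectral[Q [d [QQt QtQ HE]]] FFt t_sorted chiH.
have: perm_eq t [tuple d 0 j | j < n + m].
  apply: prod_XsubC_eq; rewrite -chiH big_map big_enum HE /=.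
  rewrite char_poly_conj // char_poly_trig ?diag_mx_is_trig //.
  by apply: eq_bigr => j _; rewrite mxE eqxx.
move=> t_perm; have size_t : size t == (n + m)%N.
  by rewrite (perm_size t_perm) size_tuple.
have /tuple_permP[s tE] : perm_eq (Tuple size_t) [tuple d 0 j | j < n + m].
  by [].
pose G := F *m Q^T.
have GGt : G *m G^T = 1%:M.
  by rewrite /G trmx_mul trmxK mulmxA -(mulmxA F) QtQ mulmx1.
pose p j := \sum_i G i (s j) ^+ 2.
have p_ge0 j : 0 <= p j by apply: sumr_ge0 => i _; rewrite sqr_ge0.
have p_le1 j : p j <= 1 by exact: orthonormal_col_le1.
have trE : \tr (F *m H *m F^T) = \sum_(j < n + m) p j * t`_j.
  have -> : F *m H *m F^T = G *m diag_mx d *m G^T.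
    by rewrite HE /G trmx_mul trmxK !mulmxA.
  rewrite /mxtrace. under eq_bigr do rewrite mxE.
  rewrite exchange_big /= (reindex_inj (@perm_inj _ s)) /=.
  apply: eq_bigr => j _. rewrite mulr_suml; apply: eq_bigr => i _.
  rewrite mul_mx_diag !mxE mulrAC -expr2; congr (_ * _).
  rewrite /= in tE; rewrite tE (nth_map j) ?size_enum_ord // nth_ord_enum.
  by rewrite tnth_mktuple.
have sum_p : \sum_j p j = n%:R.
  rewrite -(mxtrace1 R n) -GGt /mxtrace.
  under [RHS]eq_bigr do rewrite mxE.
  rewrite [RHS]exchange_big /= [RHS](reindex_inj (@perm_inj _ s)) /=.
  by apply: eq_bigr => j _; apply: eq_bigr => i _; rewrite [G^T _ _]mxE.
(* The threshold is the [n]-th smallest eigenvalue: the two factors below are both nonpositive for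
   [j < n] and both nonnegative otherwise. As both families of weights add up to [n], the terms in
   [c] cancel. *)
pose c := t`_n.-1.
have : 0 <= \sum_(j < n + m) (p j - (j < n)%N%:R) * (t`_j - c).
  apply: sumr_ge0 => j _; have [jn|jn] := ltnP j n.
    rewrite -mulrNN !opprB mulr_ge0 ?subr_ge0 //.
    have n_gt0 := leq_ltn_trans (leq0n _) jn.
    rewrite (sorted_leq_nth le_trans lexx 0 t_sorted) ?inE ?(eqP size_t) //.
      by rewrite (leq_trans _ (leq_addr _ _)) // ltn_predL.
    by rewrite -ltnS prednK.
  rewrite subr0 mulr_ge0 // subr_ge0.
  rewrite (sorted_leq_nth le_trans lexx 0 t_sorted) ?inE ?(eqP size_t) //.
    by rewrite (leq_ltn_trans (leq_trans (leq_pred n) jn)).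
  exact: leq_trans (leq_pred n) jn.
have sum_lt (f : nat -> R) :
    \sum_(j < n + m) (j < n)%N%:R * f j = \sum_(i < n) f i :> R.
  rewrite big_split_ord /= [X in _ + X]big1 ?addr0 => [|i _]; last first.
    by rewrite ltnNge leq_addr mul0r.
  by apply: eq_bigr => i _; rewrite ltn_ord mul1r.
move=> sum_ge0; rewrite trE -subr_ge0.
suff <- : \sum_(j < n + m) (p j - (j < n)%N%:R) * (t`_j - c) =
    \sum_(j < n + m) p j * t`_j - \sum_(i < n) t`_i by [].
transitivity (\sum_(j < n + m) (p j * t`_j - (j < n)%N%:R * t`_j)
    - \sum_(j < n + m) (p j * c - (j < n)%N%:R * c)).
  by rewrite -sumrB; apply: eq_bigr => j _; rewrite mulrBr !mulrBl.
rewrite !sumrB -mulr_suml sum_p (sum_lt (nth 0 t)) (sum_lt (fun=> c)).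
by rewrite sumr_const card_ord mulr_natl subrr subr0.
Qed.
End Spectra.

(** * Rank-one rigidity and determinants of rank-one perturbations *)

Section Rigidity.
Context {R : realType}.

(** A diagonalizing conjugation fixes scalar matrices, so a single list [d] serves for all shifts
    [b]. *)
Lemma symmetric_char_poly n (A : 'M[R]_n) : A^T = A ->
  exists d : seq R, forall b,
    char_poly (A + b%:M) = \prod_(a <- d) ('X - (a + b)%:P).
Proof.
move=> /symmetric_spectral[Q [d [QQt QtQ ->]]].
exists [seq d 0 i | i <- enum 'I_n] => b.
have -> : Q^T *m diag_mx d *m Q + b%:M = Q^T *m (diag_mx d + b%:M) *m Q.
  by rewrite mulmxDr mulmxDl mul_mx_scalar -scalemxAl QtQ scalemx1.
rewrite char_poly_conj // char_poly_trig.
  by rewrite big_map big_enum; apply: eq_bigr => i _; rewrite !mxE eqxx.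
apply/is_trig_mxP => i j ij; rewrite !mxE; have := ltn_eqF ij.
by rewrite val_eqE => ->; rewrite addr0.
Qed.

Lemma mxtrace_char_poly n (A : 'M[R]_n) d :
  char_poly A = \prod_(a <- d) ('X - a%:P) -> \tr A = \sum_(a <- d) a.
Proof.
move=> chiA; have size_d : size d = n.
  by have := size_char_poly A; rewrite chiA size_prod_XsubC => -[].
(* Vieta's formula reads the sum off the coefficient of degree [n - 1], which requires [n > 0]. *)
have [n0|n_gt0] := posnP n.
  have -> : d = [::] by apply: size0nil; rewrite size_d.
  rewrite big_nil /mxtrace big1 // => i.
  by have := ltn_ord i; rewrite [X in (_ < X)%N]n0.
apply: oppr_inj; rewrite -char_poly_trace // chiA -coefPn_prod_XsubC size_d //.
by rewrite -lt0n.
Qed.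

(* With e_i an orthonormal eigenbasis of C C^T, C C^T e_i = k_i e_i, the rows
   (e_i, e_i C) / sqrt (1 + k_i) are orthonormal and have energy
   q_i / (1 + k_i), where q_i = e_i N e_i^T. Since the trace of N is the sum of
   the q_i, Ky Fan's principle forces q_i = 0 whenever k_i <> 0. *)
Lemma equal_spectra_rank1 n m (A : 'M[R]_n) (C : 'M_(n, m)) (r : 'rV_n)
    (N := 1%:M - A - C *m C^T) (s t : seq R) :
    A^T = A -> sorted <=%R t ->
    char_poly (block_mx (1%:M - A) (- C) (- C^T) 1%:M) =
      \prod_(a <- t) ('X - a%:P) ->
    char_poly N = \prod_(a <- s) ('X - a%:P) ->
    (forall i, (i < n)%N -> s`_i = t`_i) ->
    (forall v : 'rV_n, 0 <= (v *m N *m v^T) 0 0) ->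
    (forall v : 'rV_n, (v *m N *m v^T) 0 0 = 0 -> exists c, v = c *: r) ->
  exists k, C = r^T *m k.
Proof.
set H := block_mx _ _ _ _ => symA t_sorted chiH chiN st N_ge0 N_ker.
have [Q [d [QQt QtQ dE]]] : exists (Q : 'M_n) (d : 'rV_n),
    [/\ Q *m Q^T = 1%:M, Q^T *m Q = 1%:M & C *m C^T = Q^T *m diag_mx d *m Q].
  by apply: symmetric_spectral; rewrite trmx_mul trmxK.
have QCC : Q *m C *m C^T *m Q^T = diag_mx d.
  by rewrite -mulmxA -[_ *m _ *m (_ *m _)]mulmxA (mulmxA C) dE !mulmxA QQt
    mul1mx -mulmxA QQt mulmx1.
have dE' i : d 0 i = (row i (Q *m C) *m (row i (Q *m C))^T) 0 0.
  have := congr1 (fun M : 'M_n => M i i) QCC.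
  rewrite [in X in _ = X -> _]mxE eqxx mulr1n => <-.
  rewrite -mulmxA -trmx_mul !mxE; apply: eq_bigr => j _.
  by rewrite !mxE.
have d_ge0 i : 0 <= d 0 i by rewrite dE' sqnorm_ge0.
have d1_neq0 i : 1 + d 0 i != 0 by rewrite gt_eqF // ltr_wpDr.
pose q i := (row i Q *m N *m (row i Q)^T) 0 0.
have qE i : q i = (Q *m N *m Q^T) i i.
  rewrite /q -row_mul [LHS]mxE [RHS]mxE; apply: eq_bigr => j _.
  by rewrite [row _ _ _ _]mxE ![_^T _ _]mxE [row _ _ _ _]mxE.
pose S := diag_mx (\row_i (Num.sqrt (1 + d 0 i))^-1).
have S2 i : (Num.sqrt (1 + d 0 i))^-1 ^+ 2 = (1 + d 0 i)^-1.
  by rewrite exprVn sqr_sqrtr // addr_ge0.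
have SMS (M : 'M_n) i j : (S *m M *m S) i j =
  (Num.sqrt (1 + d 0 i))^-1 * M i j * (Num.sqrt (1 + d 0 j))^-1.
  by rewrite mul_mx_diag mul_diag_mx !mxE.
pose F := S *m row_mx Q (Q *m C).
have FFt : F *m F^T = 1%:M.
  rewrite /F trmx_mul mulmxA -(mulmxA S) tr_row_mx mul_row_col QQt trmx_mul.
  rewrite mulmxA QCC tr_diag_mx; apply/matrixP => i j; rewrite SMS !mxE.
  have [->|_] := eqVneq i j; last by rewrite addr0 mulr0 mul0r.
  by rewrite !mulr1n mulrAC -expr2 S2 mulVf.
have := sum_smallest_le_trace _ FFt t_sorted chiH.
have -> : F *m H *m F^T = S *m (Q *m N *m Q^T) *m S.
  (* The boundary block of the product vanishes because [(v, v C)] is a harmonic extension. *)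
  have QH : row_mx Q (Q *m C) *m H = row_mx (Q *m N) 0.
    by rewrite mul_row_block mulmx1 !mulmxN addNr -mulmxA -mulmxBr.
  rewrite /F trmx_mul -(mulmxA S) QH tr_row_mx mulmxA -(mulmxA S) mul_row_col.
  by rewrite mul0mx addr0 tr_diag_mx !mulmxA.
(* Equality of the spectra enters here: both sides are the trace of [N]. *)
have -> : \sum_(i < n) t`_i = \sum_i q i.
  under [RHS]eq_bigr do rewrite qE.
  rewrite -[RHS]/(\tr _) mxtrace_mulC mulmxA QtQ mul1mx
    (mxtrace_char_poly chiN).
  rewrite (big_nth 0) big_mkord.
  have <- : n = size s.
    by have := size_char_poly N; rewrite chiN size_prod_XsubC => -[].
  by apply: eq_bigr => i _; rewrite st.
have symH : H^T = H.
  by rewrite tr_block_mx linearB /= symA !trmx1 !linearN /= trmxK.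
move=> /(_ symH); rewrite -subr_ge0 /mxtrace -sumrB => sum_le.
have term i : (S *m (Q *m N *m Q^T) *m S) i i - q i =
    - (q i * d 0 i / (1 + d 0 i)).
  rewrite SMS -qE mulrAC -expr2 S2 -mulrA.
  apply: (mulIf (d1_neq0 i)); rewrite mulrBl mulrAC mulVf // mul1r mulNr mulrA
    divfK //.
  by rewrite mulrDr mulr1 opprD addNKr.
(* Ky Fan's inequality makes a sum of nonpositive terms nonnegative, so each term is zero. *)
have term0 i : q i * d 0 i / (1 + d 0 i) = 0.
  have x_ge0 j : 0 <= q j * d 0 j / (1 + d 0 j).
    by rewrite divr_ge0 ?mulr_ge0 ?addr_ge0 // N_ge0.
  apply/eqP; rewrite eq_le x_ge0 andbT -oppr_ge0 (le_trans sum_le) //.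
  under eq_bigr do rewrite term.
  by rewrite (bigD1 i) //= gerDl sumrN oppr_le0 sumr_ge0.
(* [C] is the sum of these products over the orthonormal rows of [Q]. Either [q i = 0] and the row
   is a multiple of [r], or [d 0 i = 0] and the row is killed by [C], since [d 0 i] is the squared
   norm of its image. *)
have cases i : exists k : 'rV_m, (row i Q)^T *m (row i Q *m C) = r^T *m k.
  have /eqP := term0 i; rewrite !mulf_eq0 invr_eq0 (negPf (d1_neq0 i)) orbF.
  case/orP => /eqP.
    move=> /N_ker[c ->]; exists (c *: (c *: r *m C)).
    by rewrite linearZ /= -scalemxAl scalemxAr.
  rewrite dE' => /eqP; rewrite sqnorm_eq0 row_mul => /eqP ->.
  by exists 0; rewrite !mulmx0.
have [k kE] := fin_all_exists cases.
exists (\sum_i k i); rewrite mulmx_sumr -(eq_bigr _ (fun i _ => kE i)).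
rewrite -[C in LHS]mul1mx -QtQ -mulmxA; apply/matrixP => a b.
rewrite summxE [LHS]mxE; apply: eq_bigr => i _.
by rewrite -row_mul [RHS]mxE big_ord1 ![_^T _ _]mxE ![row _ _ _ _]mxE.
Qed.

(** Eliminating either diagonal block of the bordered matrix [M] computes its determinant in two
    ways. The factor [x] on the left avoids the exponent [n - 1], so that [n = 0] is covered. *)
Lemma det_sub_rank1 (F : idomainType) n (x : F) (u : 'cV[F]_n) (v : 'rV_n) :
  x * \det (x%:M - u *m v) = x ^+ n * (x - (v *m u) 0 0).
Proof.
pose M := block_mx (1%:M : 'M_1) v u x%:M.
have <- : \det M = \det (x%:M - u *m v).
  transitivity (\det (M *m block_mx 1%:M (- v) 0 1%:M)).
    by rewrite det_mulmx det_ublock !det1 !mulr1.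
  rewrite mulmx_block !mulmx1 !mulmx0 !mulmxN !mul1mx !addr0 addNr.
  by rewrite det_lblock det1 mul1r addrC.
have -> : x * \det M = \det (M *m block_mx x%:M 0 (- u) 1%:M).
  by rewrite det_mulmx det_lblock det1 mulr1 det_scalar1 mulrC.
rewrite mulmx_block !mulmx1 !mulmx0 !mulmxN !add0r !mul1mx mul_mx_scalar
  mul_scalar_mx.
rewrite subrr det_ublock det_scalar mulrC; congr (_ * _).
by rewrite [v *m u]mx11_scalar -raddfB det_scalar1 [in RHS]mxE eqxx.
Qed.

(** * Schur complements with the rank-one projection [J] onto a kernel vector of [N] *)

Section Projection.
Variables (n m : nat) (N : 'M[R]_n) (u : 'cV[R]_n) (v : 'rV[R]_n) (b : R).
Hypotheses (Nu : N *m u = 0) (vu : v *m u = 1%:M).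
Let J := u *m v.
Local Notation polymx := (map_mx polyC).

Lemma det_scalar_sub_proj x :
  x * \det (x%:M - b%:P *: polymx J) = x ^+ n * (x - b%:P).
Proof.
rewrite map_mxM scalemxAl det_sub_rank1 -scalemxAr -map_mxM vu map_mx1.
by rewrite !mxE mulr1.
Qed.

(** Since [N J = 0], one has [(X - N) (X - b J) = X (X - N - b J)]. Adding [b J] thus moves one
    eigenvalue from 0 to [b]. *)
Lemma char_poly_add_proj :
  char_poly N * ('X - b%:P) = 'X * char_poly (N + b *: J).
Proof.
have eqX : char_poly_mx N *m ('X%:M - b%:P *: polymx J) =
    'X *: char_poly_mx (N + b *: J).
  rewrite mulmxBr mul_mx_scalar -scalemxAr [_ *m polymx J]mulmxBl.
  rewrite -map_mxM mulmxA Nu mul0mx map_mx0 subr0 mul_scalar_mx.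
  by rewrite scalerA mulrC -scalerA -scalerBr /char_poly_mx map_mxD map_mxZ
    opprD addrA.
apply: (mulfI (expf_neq0 n (negbT (polyX_eq0 R)))).
rewrite mulrCA -det_scalar_sub_proj mulrCA -det_mulmx eqX detZ.
by rewrite mulrCA.
Qed.

(** With [y = X - 1], clearing the lower left block leaves [(X - N - b J) y - b J] above it, which
    equals [(X - N) (y - b J)] because [(X - N) J = X J]. *)
Lemma char_poly_block_proj (C : 'M_(n, m)) (C' : 'M_(m, n)) :
    C *m C' = b *: J ->
  char_poly (block_mx (N + b *: J) (- C) (- C') 1%:M) * ('X - 1) =
    char_poly N * ('X - (1 + b)%:P) * ('X - 1) ^+ m.
Proof.
move=> CC'; have X1 : 'X - 1 != 0 :> {poly R} by rewrite polyXsubC_eq0.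
set y := 'X - 1.
have blockE : char_poly_mx (block_mx (N + b *: J) (- C) (- C') 1%:M) =
    block_mx (char_poly_mx N - b%:P *: polymx J) (polymx C) (polymx C') y%:M.
  rewrite /char_poly_mx map_block_mx !map_mxN map_mx1 map_mxD map_mxZ.
  by rewrite scalar_mx_block opp_block_mx add_block_mx !sub0r !opprK opprD
    addrA -raddfB.
have XJ : char_poly_mx N *m polymx J = 'X *: polymx J.
  by rewrite mulmxBl -map_mxM mulmxA Nu mul0mx map_mx0 subr0 mul_scalar_mx.
have elim_C : block_mx (char_poly_mx N - b%:P *: polymx J) (polymx C)
      (polymx C') y%:M *m
      block_mx y%:M 0 (- polymx C') 1%:M =
    block_mx (char_poly_mx N *m (y%:M - b%:P *: polymx J)) (polymx C) 0 y%:M.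
  rewrite mulmx_block !mulmx1 !mulmx0 !add0r !mulmxN !mul_mx_scalar
    mul_scalar_mx subrr.
  congr block_mx; rewrite -map_mxM CC' map_mxZ mulmxBr mul_mx_scalar -scalemxAr
    XJ.
  rewrite scalerBr !scalerA -addrA -opprD -scalerDl; congr (_ - _ *: _).
  by rewrite mulrBl mul1r subrK mulrC.
apply: (mulIf (expf_neq0 n X1)); rewrite -/y [LHS]mulrAC.
have -> : char_poly (block_mx (N + b *: J) (- C) (- C') 1%:M) * y ^+ n =
    char_poly N * \det (y%:M - b%:P *: polymx J) * y ^+ m.
  rewrite {1}/char_poly blockE -(det_scalar n) -[in RHS]det_scalar -det_mulmx.
  by rewrite -(det_ublock _ (polymx C)) -elim_C det_mulmx det_lblock det1 mulr1.
have -> : 'X - (1 + b)%:P = y - b%:P by rewrite polyCD opprD addrA.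
transitivity (char_poly N * (y * \det (y%:M - b%:P *: polymx J)) * y ^+ m).
  by ring.
by rewrite det_scalar_sub_proj; ring.
Qed.
End Projection.
End Rigidity.

(** * Pointwise formulas for the Laplacian *)

Section LaplacianExpressions.
Context {R : realType} {V : finType}.

Lemma laplacianE (G : wgraph R V) u x :
  laplacian G u x = Deg G x * u x - (vm G x)^-1 * \sum_y u y * ew G x y.
Proof.
rewrite ffunE /Deg -mulrA -mulrBr mulr_suml -sumrB; congr (_ * _).
by apply: eq_bigr => y _; rewrite mulrBl (mulrC (u x)).
Qed.

Lemma laplacian_delta (G : wgraph R V) x y :
  laplacian G [ffun z => (z == y)%:R] x =
    Deg G x * (x == y)%:R - (vm G x)^-1 * ew G x y.
Proof.
rewrite laplacianE ffunE; congr (_ - _ * _).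
rewrite (bigD1 y) //= ffunE eqxx mul1r big1 ?addr0 // => z /negPf zy.
by rewrite ffunE zy mul0r.
Qed.

Lemma ew_ge0 (G : wgraph R V) x y : 0 <= ew G x y.
Proof. by have [/ew_gt0/ltW //|/ew_eq0 ->] := boolP (adj G x y). Qed.

End LaplacianExpressions.

(** * Symmetrized block matrices of a normalized graph without boundary edges *)

Section NormalizedGraph.
Context {R : realType} {V : finType} (G : wgraph R V) (B : {set V}).
Hypotheses (G_conn : connected_graph G) (G_norm : normalized G).
Hypothesis EBB : forall x y, x \in B -> y \in B -> ~~ adj G x y.
Local Notation Omega := (~: B).
Local Notation n := #|~: B|.
Local Notation m := #|B|.

Lemma ew_BB x y : x \in B -> y \in B -> ew G x y = 0.
Proof. by move=> xB yB; apply/ew_eq0/EBB. Qed.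

Lemma sum_ew x : \sum_y ew G x y = vm G x.
Proof.
have /(congr1 ( *%R (vm G x))) := G_norm x.
by rewrite /Deg mulVKf ?mulr1 // gt_eqF // vm_gt0.
Qed.

(** Harmonicity at a boundary vertex expresses its value as the weighted mean of interior values
    only. The explicit formula proves existence, so the chosen extension is not the default, and
    every extension obeys it. *)
Lemma neumann_ext_delta (y : {x | x \in Omega}) :
  let f := neumann_ext G [ffun z => (z == y)%:R] in
  (forall z, z \in Omega -> f z = (z == val y)%:R) /\
  (forall z, z \in B -> f z = (vm G z)^-1 * ew G z (val y)).
Proof.
have yNB : val y \notin B by have := valP y; rewrite inE.
have sum_f (f : {ffun V -> R}) z :
    (forall z, z \in Omega -> f z = (z == val y)%:R) ->
    z \in B -> \sum_t f t * ew G z t = ew G z (val y).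
  move=> fO zB; rewrite (bigD1 (val y)) //= fO ?eqxx ?inE // mul1r.
  rewrite big1 ?addr0 // => t /negPf ty; have [tB|tNB] := boolP (t \in B).
    by rewrite ew_BB // mulr0.
  by rewrite fO ?inE // ty mul0r.
move=> f; have [] : is_neumann_ext G [ffun z => (z == y)%:R] f.
  apply: (@classical_sets.xgetPex _ (0 : {ffun V -> R})
    (fun f => is_neumann_ext G _ f)).
  exists [ffun z => if z \in B then (vm G z)^-1 * ew G z (val y)
                    else (z == val y)%:R].
  split=> [x|x xB].
    by have := valP x; rewrite inE => /negPf xB; rewrite !ffunE xB val_eqE.
  rewrite laplacianE ffunE xB G_norm mul1r sum_f ?subrr // => z.
  by rewrite inE ffunE => /negPf ->.
move=> fO fB; have fO' z : z \in Omega -> f z = (z == val y)%:R.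
  by move=> zO; have := fO (exist _ z zO); rewrite ffunE => /= ->;
    rewrite -val_eqE.
split=> // z zB; have /eqP := fB z zB.
by rewrite laplacianE G_norm mul1r sum_f // subr_eq0 => /eqP.
Qed.

Let sq x := Num.sqrt (vm G x).
Let sq_gt0 x : 0 < sq x. Proof. by rewrite sqrtr_gt0 vm_gt0. Qed.
Let sq_neq0 x : sq x != 0. Proof. by rewrite gt_eqF. Qed.
Let sqr_sq x : sq x ^+ 2 = vm G x.
Proof. by rewrite sqr_sqrtr // ltW // vm_gt0. Qed.

(** Kernel of the walk [ew G x y / vm G x] conjugated by the square roots of the measure. Its blocks
    [weight_OO] and [weight_OB] are the matrices [A] and [C]. *)
Definition sym_weight x y := ew G x y / (sq x * sq y).
Definition weight_OO :=
  \matrix_(i < n, j < n) sym_weight (enum_val i) (enum_val j).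
Definition weight_OB :=
  \matrix_(i < n, j < m) sym_weight (enum_val i) (enum_val j).

Definition block_val (k : 'I_(n + m)) : V :=
  match split k with inl i => enum_val i | inr j => enum_val j end.

Lemma block_val_bij : bijective block_val.
Proof.
apply: inj_card_bij; last by rewrite card_ord addnC cardsC.
move=> k l; rewrite -(splitK k) -(splitK l) /block_val !unsplitK.
case: (split k) (split l) => [i|i] [j|j] /=.
- by move/enum_val_inj ->.
- by move=> ij; have := enum_valP i; rewrite ij inE enum_valP.
- by move=> ij; have := enum_valP j; rewrite -ij inE enum_valP.
- by move/enum_val_inj ->.
Qed.

Definition laplacian_mx : 'M[R]_(n + m) :=
  block_mx (1%:M - weight_OO) (- weight_OB) (- weight_OB^T) 1%:M.

Lemma sym_weightC x y : sym_weight x y = sym_weight y x.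
Proof. by rewrite /sym_weight ew_sym (mulrC (sq x)). Qed.

Lemma laplacian_mxE k l :
  laplacian_mx k l = (k == l)%:R - sym_weight (block_val k) (block_val l).
Proof.
rewrite -(splitK k) -(splitK l) /block_val !unsplitK.
case: (split k) (split l) => [i|i] [j|j] /=.
- by rewrite block_mxEul !mxE (inj_eq (@lshift_inj _ _)).
- by rewrite block_mxEur !mxE eq_lrshift sub0r.
- by rewrite block_mxEdl !mxE eq_rlshift sub0r sym_weightC.
- rewrite block_mxEdr !mxE (inj_eq (@rshift_inj _ _)) /sym_weight.
  by rewrite ew_BB ?enum_valP // mul0r subr0.
Qed.

Lemma char_poly_laplacian :
  char_poly (op_mx (laplacian G)) = char_poly laplacian_mx.
Proof.
apply: (char_poly_op_mx (s := fun k => (sq (block_val k))^-1) block_val_bij).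
  by move=> k; rewrite invr_neq0.
move=> k l; rewrite laplacian_delta G_norm mul1r laplacian_mxE invrK.
rewrite (inj_eq (bij_inj block_val_bij)) mulrBr mulrBl; congr (_ - _).
  case: eqP => [->|_]; last by rewrite mulr0 mul0r.
  by rewrite mulr1 mulVf.
rewrite /sym_weight -sqr_sq; field.
by rewrite !sq_neq0.
Qed.

Let omega_val (i : 'I_n) : {x | x \in Omega} :=
  exist _ (enum_val i) (enum_valP i).

Let omega_val_bij : bijective omega_val.
Proof.
apply: inj_card_bij; last by rewrite card_ord card_sig.
by move=> i j /(congr1 val)/enum_val_inj.
Qed.

Lemma char_poly_neumann : char_poly (op_mx (@neumann_laplacian R V G B)) =
  char_poly (1%:M - weight_OO - weight_OB *m weight_OB^T).
Proof.
apply: (char_poly_op_mx (s := fun i => (sq (enum_val i))^-1) omega_val_bij).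
  by move=> k; rewrite invr_neq0.
move=> i j; rewrite ffunE invrK laplacianE G_norm mul1r.
have [fO fB] := neumann_ext_delta (omega_val j).
(* The boundary part of the sum yields [C C^T]; in the interior part only [enum_val j] survives,
   yielding [A]. *)
rewrite fO ?enum_valP // (bigID (mem B)) /=.
rewrite [\sum_(_ | _ \notin _) _](bigD1 (enum_val j)) /=;
  last by have := enum_valP j; rewrite inE.
rewrite fO ?enum_valP // eqxx mul1r [\sum_(_ | _ && _) _]big1 ?addr0;
  last first.
  by move=> t /andP[tB /negPf tj]; rewrite fO ?inE // tj mul0r.
rewrite (inj_eq enum_val_inj) !mxE.
under eq_bigr => t tB do rewrite fB //.
rewrite [in LHS]big_enum_val /=.
rewrite mulrDr opprD addrA [in LHS]addrAC !mulrBr !mulrBl; congr (_ - _ - _).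
- case: eqP => [->|_]; last by rewrite mulr0 mul0r.
  by rewrite mulr1 mulVf.
- rewrite /sym_weight -sqr_sq; field.
  by rewrite !sq_neq0.
rewrite mulr_sumr [in RHS]mulr_sumr mulr_suml; apply: eq_bigr => k _.
rewrite !mxE /sym_weight -!sqr_sq (ew_sym G (enum_val k)); field.
by rewrite !sq_neq0.
Qed.


Definition sqrt_vm_O : 'rV_n := \row_i sq (enum_val i).
Definition sqrt_vm_B : 'rV_m := \row_i sq (enum_val i).

Lemma sqnorm_sqrt_vm_O : sqrt_vm_O *m sqrt_vm_O^T = (volume G Omega)%:M.
Proof.
apply/matrixP => i j; rewrite !ord1 !mxE mulr1n /volume [RHS]big_enum_val /=.
by apply: eq_bigr => k _; rewrite !mxE -sqr_sq expr2.
Qed.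

Lemma sqnorm_sqrt_vm_B : sqrt_vm_B *m sqrt_vm_B^T = (volume G B)%:M.
Proof.
apply/matrixP => i j; rewrite !ord1 !mxE mulr1n /volume [RHS]big_enum_val /=.
by apply: eq_bigr => k _; rewrite !mxE -sqr_sq expr2.
Qed.

Lemma trmx_weight_OO : weight_OO^T = weight_OO.
Proof. by apply/matrixP => i j; rewrite !mxE sym_weightC. Qed.

Lemma sum_ew_split x :
  \sum_(i < n) ew G x (enum_val i) + \sum_(j < m) ew G x (enum_val j) = vm G x.
Proof.
rewrite -sum_ew (bigID (mem B)) /= addrC -!big_enum_val /=.
by congr (_ + _); apply: eq_bigl => y; rewrite inE.
Qed.

Lemma sum_ew_B x : x \in B -> \sum_(i < n) ew G x (enum_val i) = vm G x.
Proof.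
by move=> xB; rewrite -sum_ew_split [X in _ + X]big1 ?addr0 // => j _;
  rewrite ew_BB ?enum_valP.
Qed.

(** Constants correspond to square roots of the measure after conjugation: the harmonic extension of
    a constant is that constant, as all the weight of a boundary vertex goes to the interior. *)
Lemma weight_OB_sqrt_vm : weight_OB^T *m sqrt_vm_O^T = sqrt_vm_B^T.
Proof.
apply/matrixP => j k; rewrite !mxE ord1.
rewrite -[RHS](mulfK (sq_neq0 (enum_val j))) -expr2 sqr_sq -sum_ew_B ?enum_valP
  //.
rewrite mulr_suml; apply: eq_bigr => i _; rewrite !mxE /sym_weight ew_sym;
  field.
by rewrite !sq_neq0.
Qed.

Lemma neumann_mx_sqrt_vm :
  (1%:M - weight_OO - weight_OB *m weight_OB^T) *m sqrt_vm_O^T = 0.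
Proof.
rewrite 2!mulmxBl mul1mx -mulmxA weight_OB_sqrt_vm -addrA -opprD.
apply/eqP; rewrite subr_eq0; apply/eqP/matrixP => i k; rewrite !mxE.
rewrite -[LHS](mulfK (sq_neq0 (enum_val i))) -expr2 sqr_sq -sum_ew_split.
rewrite mulrDl !mulr_suml; congr (_ + _); apply: eq_bigr => j _.
  by rewrite !mxE /sym_weight; field; rewrite !sq_neq0.
by rewrite !mxE /sym_weight; field; rewrite !sq_neq0.
Qed.

(** With an empty interior, a boundary vertex would have no incident weight, against its positive
    measure. *)
Lemma volume_Omega_gt0 : B != set0 -> 0 < volume G Omega.
Proof.
case/set0Pn => x xB; have [O0|[y yO]] := set_0Vmem Omega.
  have := sum_ew_B xB; rewrite -big_enum_val /= O0 big_set0 => vx.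
  by have := vm_gt0 G x; rewrite -vx ltxx.
by rewrite /volume (bigD1 y) //= ltr_pwDl ?vm_gt0 // sumr_ge0 // => z _;
  rewrite ltW ?vm_gt0.
Qed.

(** Dirichlet form of the function [z / sq]; the factor one half compensates for counting each edge
    twice. *)
Lemma energy (z : 'rV[R]_(n + m)) :
  (z *m laplacian_mx *m z^T) 0 0 = 2^-1 *
    \sum_k \sum_l ew G (block_val k) (block_val l) *
      (z 0 k / sq (block_val k) - z 0 l / sq (block_val l)) ^+ 2.
Proof.
set g := block_val; pose f k := z 0 k / sq (g k).
have sum_l k : \sum_l ew G (g k) (g l) = vm G (g k).
  by rewrite -sum_ew (reindex g) //; exact/onW_bij/block_val_bij.
have zE k : z 0 k = f k * sq (g k) by rewrite /f divfK.
have -> : (z *m laplacian_mx *m z^T) 0 0 =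
    \sum_k vm G (g k) * f k ^+ 2 - \sum_k \sum_l ew G (g k) (g l) * (f k * f l).
  rewrite mxE -sumrB; apply: eq_bigr => l _; rewrite !mxE mulr_suml.
  under eq_bigr do rewrite laplacian_mxE mulrBr mulrBl.
  rewrite sumrB (bigD1 l) //= eqxx mulr1 big1 ?addr0; last first.
    by move=> k /negPf ->; rewrite mulr0 mul0r.
  rewrite !zE -sqr_sq; congr (_ - _); first by ring.
  apply: eq_bigr => k _; rewrite zE /sym_weight ew_sym -/g; field.
  by rewrite !sq_neq0.
have -> : \sum_k \sum_l ew G (g k) (g l) * (f k - f l) ^+ 2 =
    \sum_k vm G (g k) * f k ^+ 2 + \sum_k vm G (g k) * f k ^+ 2
    - 2 * \sum_k \sum_l ew G (g k) (g l) * (f k * f l).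
  have E1 : \sum_k vm G (g k) * f k ^+ 2 =
      \sum_k \sum_l ew G (g k) (g l) * f k ^+ 2.
    by apply: eq_bigr => k _; rewrite -mulr_suml sum_l.
  have E2 : \sum_k vm G (g k) * f k ^+ 2 =
      \sum_k \sum_l ew G (g k) (g l) * f l ^+ 2.
    rewrite E1 exchange_big; apply: eq_bigr => k _; apply: eq_bigr => l _.
    by rewrite ew_sym.
  rewrite {1}E1 E2 -big_split mulr_sumr -sumrB; apply: eq_bigr => k _ /=.
  rewrite -big_split mulr_sumr -sumrB; apply: eq_bigr => l _ /=; ring.
by field.
Qed.

Lemma energy_ge0 (z : 'rV_(n + m)) : 0 <= (z *m laplacian_mx *m z^T) 0 0.
Proof.
rewrite energy mulr_ge0 ?invr_ge0 ?ler0n // sumr_ge0 // => k _.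
by apply: sumr_ge0 => l _; rewrite mulr_ge0 ?sqr_ge0 ?ew_ge0.
Qed.

(** Zero energy kills every difference of [z / sq] along an edge, and connectedness makes this
    function constant. *)
Lemma energy_eq0 (z : 'rV_(n + m)) : (z *m laplacian_mx *m z^T) 0 0 = 0 ->
  exists c, forall k, z 0 k = c * sq (block_val k).
Proof.
have [gi gK giK] := block_val_bij.
have w_ge0 k l : 0 <= ew G (block_val k) (block_val l) *
      (z 0 k / sq (block_val k) - z 0 l / sq (block_val l)) ^+ 2.
  by rewrite mulr_ge0 ?sqr_ge0 ?ew_ge0.
rewrite energy => /eqP; rewrite mulf_eq0 invr_eq0 pnatr_eq0 /= psumr_eq0;
  last first.
  by move=> k _; exact: sumr_ge0.
move=> /allP z0.
pose f x := z 0 (gi x) / sq x.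
have f_adj x y : adj G x y -> f x = f y.
  move=> xy; have := z0 (gi x); rewrite mem_index_enum => /(_ isT).
  rewrite psumr_eq0 // => /allP/(_ (gi y)); rewrite mem_index_enum => /(_ isT).
  rewrite !giK mulf_eq0 gt_eqF ?ew_gt0 //= sqrf_eq0 subr_eq0.
  by move=> /eqP.
have f_const x y : f x = f y.
  have /connectP[p] := G_conn x y; elim: p x =>
    [x _ -> //|t p IHp x /= /andP[xt tp] yE].
  by rewrite (f_adj _ _ xt) (IHp t).
(* The constant is read off at any index; without indices any constant will do. *)
have [k0 _|no_k] := pickP (fun k : 'I_(n + m) => true).
  exists (f (block_val k0)) => k.
  by rewrite (f_const _ (block_val k)) /f gK divfK.
by exists 0 => k; have := no_k k.
Qed.

(** The Neumann form is the full Dirichlet form of the harmonic extension, from which it inherits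
    its sign and its kernel. *)
Lemma neumann_energy (v : 'rV_n) :
  v *m (1%:M - weight_OO - weight_OB *m weight_OB^T) *m v^T =
    row_mx v (v *m weight_OB) *m laplacian_mx *m (row_mx v (v *m weight_OB))^T.
Proof.
rewrite /laplacian_mx mul_row_block mulmx1 !mulmxN addNr
  -[v *m weight_OB *m _]mulmxA -mulmxBr.
by rewrite tr_row_mx mul_row_col mul0mx addr0.
Qed.

Lemma neumann_energy_eq0 (v : 'rV_n) :
  (v *m (1%:M - weight_OO - weight_OB *m weight_OB^T) *m v^T) 0 0 = 0 ->
  exists c, v = c *: sqrt_vm_O.
Proof.
rewrite neumann_energy => /energy_eq0[c cE]; exists c; apply/rowP => i.
have := cE (lshift m i); rewrite row_mxEl /block_val.
by rewrite -[lshift m i]/(unsplit (inl i)) unsplitK !mxE.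
Qed.

(** Rank one makes [ew G x z] proportional to [vm G z] for fixed [x]; summing over the interior to
    [vm G x] determines the factor. *)
Lemma ew_of_weight_OB_rank1 (k : 'rV_m) : weight_OB = sqrt_vm_O^T *m k ->
  forall x y, x \in B -> y \in Omega ->
    ew G x y = (volume G Omega)^-1 * vm G x * vm G y.
Proof.
move=> kE x y xB yO; pose j := enum_rank_in xB x; pose c := sq x * k 0 j.
have wE z : z \in Omega -> ew G x z = c * vm G z.
  move=> zO; have /matrixP/(_ (enum_rank_in zO z) j) := kE.
  rewrite !mxE big_ord1 !mxE !enum_rankK_in // /sym_weight.
  move=> /(congr1 ( *%R^~ (sq z * sq x))).
  rewrite divfK ?mulf_neq0 // ew_sym => ->; rewrite /c -sqr_sq; ring.
have VO_neq0 : volume G Omega != 0.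
  by rewrite gt_eqF // volume_Omega_gt0 //; apply/set0Pn; exists x.
rewrite wE //; congr (_ * _); apply: (mulIf VO_neq0).
rewrite [RHS]mulrAC mulVf // mul1r -[RHS]sum_ew_B // mulr_sumr
  [LHS]big_enum_val /=.
by apply: eq_bigr => i _; rewrite wE ?enum_valP.
Qed.

(** * Characteristic polynomials under condition (1) *)

Section ConstantWeights.
Hypothesis B_neq0 : B != set0.
Hypothesis ewE : forall x y, x \in B -> y \in Omega ->
  ew G x y = (volume G Omega)^-1 * vm G x * vm G y.
Local Notation b := (volume G B / volume G Omega).

Lemma weight_OB_rank1 :
  weight_OB = sqrt_vm_O^T *m ((volume G Omega)^-1 *: sqrt_vm_B).
Proof.
apply/matrixP => i j; rewrite !mxE big_ord1 !mxE /sym_weight ew_sym.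
rewrite ewE ?enum_valP // -!sqr_sq; field.
by rewrite !sq_neq0 gt_eqF // volume_Omega_gt0.
Qed.


(** Each interior vertex loses the same proportion [b] of its weight to the boundary, so the induced
    Laplacian is a scalar minus a weight matrix. *)
Lemma Deg_induced x : Deg (induced G Omega) x = 1 - b.
Proof.
have vx := lt0r_neq0 (vm_gt0 G (val x)).
apply: (mulfI vx); rewrite /Deg mulVKf // mulrBr mulr1.
rewrite -[X in X - _]sum_ew_split (reindex omega_val) /=; last exact: onW_bij.
suff <- : \sum_(j < m) ew G (val x) (enum_val j) = vm G (val x) * b.
  by rewrite addrK.
rewrite mulrA [in RHS]mulrAC [volume G B]big_enum_val mulr_sumr /=.
by apply: eq_bigr => j _; rewrite ew_sym ewE ?enum_valP ?(valP x) // mulrC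
  mulrA.
Qed.

Lemma char_poly_induced :
  char_poly (op_mx (laplacian (induced G Omega))) =
    char_poly ((1 - b)%:M - weight_OO).
Proof.
apply: (char_poly_op_mx (s := fun i => (sq (enum_val i))^-1) omega_val_bij).
  by move=> k; rewrite invr_neq0.
move=> i j; rewrite laplacian_delta Deg_induced invrK !mxE.
rewrite (inj_eq (bij_inj omega_val_bij)) [in RHS]mulrBr [in RHS]mulrBl;
  congr (_ - _).
  case: eqP => [->|_]; last by rewrite !mulr0 mul0r.
  by rewrite mulr1n mulrAC mulVf // mulr1 mul1r.
rewrite /= /sym_weight -sqr_sq; field.
by rewrite !sq_neq0.
Qed.

Local Notation J := (sqrt_vm_O^T *m ((volume G Omega)^-1 *: sqrt_vm_O)).
Local Notation N := (1%:M - weight_OO - weight_OB *m weight_OB^T).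

(** [J] is the orthogonal projection onto the line of [sqrt_vm_O], and [b] collects the squared norm
    of [sqrt_vm_B]. *)
Lemma weight_OB_sqr : weight_OB *m weight_OB^T = b *: J.
Proof.
rewrite weight_OB_rank1 trmx_mul trmxK -mulmxA (mulmxA (_ *: _)).
rewrite linearZ /= -scalemxAl -scalemxAr sqnorm_sqrt_vm_B !scale_scalar_mx.
by rewrite mul_scalar_mx -!scalemxAr !scalerA; congr (_ *: _); ring.
Qed.

Let normalized_sqrt_vm :
  ((volume G Omega)^-1 *: sqrt_vm_O) *m sqrt_vm_O^T = 1%:M.
Proof.
rewrite -scalemxAl sqnorm_sqrt_vm_O scale_scalar_mx mulVf //.
by rewrite gt_eqF // volume_Omega_gt0.
Qed.

Lemma char_poly_neumann_laplacian : (0 < m)%N ->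
  char_poly laplacian_mx =
    char_poly N * ('X - (1 + b)%:P) * ('X - 1) ^+ m.-1.
Proof.
move=> m_gt0; have X1 : 'X - 1 != 0 :> {poly R} by rewrite polyXsubC_eq0.
apply: (mulIf X1); rewrite -[RHS]mulrA -exprSr prednK //.
rewrite -(char_poly_block_proj
  neumann_mx_sqrt_vm normalized_sqrt_vm weight_OB_sqr).
by rewrite -weight_OB_sqr subrK.
Qed.

(** Both [N + b J] and the symmetrized induced Laplacian plus [b] equal [1 - A]. *)
Lemma char_poly_neumann_induced :
  char_poly N * ('X - b%:P) = 'X * char_poly ((1 - b)%:M - weight_OO + b%:M).
Proof.
rewrite (char_poly_add_proj b neumann_mx_sqrt_vm normalized_sqrt_vm)
  -weight_OB_sqr subrK.
by rewrite addrAC -raddfD subrK.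
Qed.

End ConstantWeights.
End NormalizedGraph.

(** * Comparison of sorted lists *)

Section SortedPrefix.
Context {R : realType}.
Implicit Types s t e l : seq R.

(** Agreement on the prefix means that [t] is [s] followed by a rearrangement of [e]; this is sorted
    only if [e] lies above [s]. Conversely [s] followed by the sorted [e] is sorted, hence equal to
    [t]. *)
Lemma sorted_prefixP s t e : sorted <=%R s -> sorted <=%R t ->
    perm_eq t (s ++ e) ->
  (forall i, (i < size s)%N -> s`_i = t`_i) <->
  (forall x y, x \in s -> y \in e -> x <= y).
Proof.
move=> s_sorted t_sorted t_perm; split=> [st x y xs ye|s_le_e i i_lt].
  have takeE : take (size s) t = s.
    have size_s : size (take (size s) t) = size s.
      by rewrite size_takel // (perm_size t_perm) size_cat leq_addr.
    apply: (eq_from_nth (x0 := 0) size_s) => i; rewrite size_s => i_lt.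
    by rewrite nth_take // st.
  have tE : t = s ++ drop (size s) t by rewrite -{1}takeE cat_take_drop.
  move: t_perm t_sorted; rewrite tE perm_cat2l => /perm_mem e_drop.
  rewrite (sorted_pairwise le_trans) pairwise_cat => /andP[/allrelP + _].
  by apply=> //; rewrite e_drop.
have -> : t = s ++ sort <=%R e.
  apply: (sorted_eq le_trans le_anti) => //.
    rewrite (sorted_pairwise le_trans) pairwise_cat
      -!(sorted_pairwise le_trans).
    rewrite s_sorted sort_le_sorted !andbT.
    by apply/allrelP => x y xs; rewrite mem_sort => /s_le_e; apply.
  by rewrite (perm_trans t_perm) // perm_cat2l perm_sym perm_sort.
by rewrite nth_cat i_lt.
Qed.

(** The lists [s] and [l + b] differ only by the entries [b] and 0, both at most [c], so the bound
    is tested at the last entry of [l]. *)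
Lemma shifted_spectrum_leP b c s l : sorted <=%R l -> (0 < size l)%N ->
    perm_eq (b :: s) (0 :: [seq a + b | a <- l]) -> 0 <= c -> b <= c ->
  (forall x, x \in s -> x <= c) <-> l`_(size l).-1 + b <= c.
Proof.
move=> l_sorted l_gt0 /perm_mem sl c_ge0 b_le; split=> [s_le|l_le x xs].
  have : l`_(size l).-1 + b \in b :: s.
    by rewrite sl inE (map_f (+%R^~ b)) ?orbT // mem_nth // prednK.
  by rewrite inE => /predU1P[->|/s_le].
have : x \in 0 :: [seq a + b | a <- l] by rewrite -sl inE xs orbT.
rewrite inE => /predU1P[->//|/mapP[a al ->]]; apply: le_trans l_le.
rewrite lerD2r -(nth_index 0 al) (sorted_leq_nth le_trans lexx 0 l_sorted) ?inE
  ?index_mem //.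
  by rewrite prednK.
by rewrite -ltnS prednK // index_mem.
Qed.
End SortedPrefix.

(** Symmetry of [A] makes the polynomial split over the reals, so the computed list carries the full
    spectrum and follows scalar shifts. *)
Lemma char_poly_eigenvalues (R : realType) (T : finType)
    (L : {ffun T -> R} -> {ffun T -> R}) n (A : 'M[R]_n) : A^T = A ->
    char_poly (op_mx L) = char_poly A ->
  char_poly A = \prod_(a <- eigenvalues L) ('X - a%:P) /\
  (forall b,
    char_poly (A + b%:M) = \prod_(a <- eigenvalues L) ('X - (a + b)%:P)).
Proof.
move=> /symmetric_char_poly[d dE] LA.
have chiA : char_poly A = \prod_(a <- d) ('X - a%:P).
  by have := dE 0; rewrite raddf0 addr0; under eq_bigr do rewrite addr0.
have d_perm : perm_eq (eigenvalues L) d by apply: eigenvalues_perm; rewrite LA.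
by split=> [|b]; rewrite (perm_big d d_perm).
Qed.

(** * Equality of the spectra and conditions (1) and (2) *)

Theorem corollary1p2 (R : realType) (V : finType) (G : wgraph R V)
    (B : {set V})
    (B_neq0 : B != set0)
    (G_conn : connected_graph G)
    (G_norm : normalized G)
    (EBB : forall x y, x \in B -> y \in B -> ~~ adj G x y) :
  let Omega := ~: B in
  (forall i : nat, (1 <= i <= #|Omega|)%N -> nu G B i = mu G i) <->
  ((forall x y, x \in B -> y \in Omega ->
      ew G x y = (volume G Omega)^-1 * vm G x * vm G y) /\
   (((2 <= #|B|)%N ->
       mu (induced G Omega) #|Omega|
         <= (volume G Omega - volume G B) / volume G Omega) /\
    (#|B| = 1%N -> mu (induced G Omega) #|Omega| <= 1))).
Proof.
move=> Omega.
set P := laplacian_mx G B.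
set N := 1%:M - weight_OO G B - weight_OB G B *m (weight_OB G B)^T.
set s := eigenvalues (@neumann_laplacian R V G B).
set t := eigenvalues (laplacian G).
have VO_gt0 : 0 < volume G Omega by exact: volume_Omega_gt0.
have m_gt0 : (0 < #|B|)%N by rewrite card_gt0.
have symP : P^T = P.
  by rewrite tr_block_mx linearB !linearN /= trmxK !trmx1 trmx_weight_OO.
have symN : N^T = N.
  by rewrite !linearB /= trmx1 trmx_weight_OO trmx_mul trmxK.
have [chiP _] := char_poly_eigenvalues symP (char_poly_laplacian G_norm EBB).
have [chiN _] := char_poly_eigenvalues symN (char_poly_neumann G_norm EBB).
rewrite -/t -/s in chiP chiN.
have size_s : size s = #|Omega|.
  by have := size_char_poly N; rewrite chiN size_prod_XsubC => -[].
have s_sorted := eigenvalues_sorted (@neumann_laplacian R V G B).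
have t_sorted := eigenvalues_sorted (laplacian G).
have nu_muE : (forall i, (1 <= i <= #|Omega|)%N -> nu G B i = mu G i) <->
    (forall i, (i < size s)%N -> s`_i = t`_i).
  by rewrite size_s; split=> [st i i_lt|st [|i] // i_lt];
    [exact: (st i.+1)|exact: st].
rewrite nu_muE.
(* Once (1) holds, equality of the spectra is equivalent to (2); beyond this, only the derivation of
   (1) from equality remains. *)
suff cond2 : (forall x y, x \in B -> y \in Omega ->
      ew G x y = (volume G Omega)^-1 * vm G x * vm G y) ->
    (forall i, (i < size s)%N -> s`_i = t`_i) <->
    (((2 <= #|B|)%N -> mu (induced G Omega) #|Omega|
         <= (volume G Omega - volume G B) / volume G Omega) /\
    (#|B| = 1%N -> mu (induced G Omega) #|Omega| <= 1)).
  split=> [st|[ewE /(cond2 ewE)//]].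
  suff ewE : forall x y, x \in B -> y \in Omega ->
      ew G x y = (volume G Omega)^-1 * vm G x * vm G y.
    by split=> //; exact/(cond2 ewE).
  have [k kE] : exists k, weight_OB G B = (sqrt_vm_O G B)^T *m k.
    apply: (equal_spectra_rank1 (trmx_weight_OO G B) t_sorted chiP chiN).
    - by rewrite -size_s.
    - by move=> v; rewrite neumann_energy energy_ge0.
    - by move=> v; apply: neumann_energy_eq0.
  exact: ew_of_weight_OB_rank1 kE.
move=> ewE.
set b := volume G B / volume G Omega.
set l := eigenvalues (laplacian (induced G Omega)).
have symL : ((1 - b)%:M - weight_OO G B)^T = (1 - b)%:M - weight_OO G B.
  by rewrite linearB /= tr_scalar_mx trmx_weight_OO.
have [chiL chiLb] := char_poly_eigenvalues symL (char_poly_induced G_norm ewE).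
have size_l : size l = #|Omega|.
  by have := size_char_poly ((1 - b)%:M - weight_OO G B);
    rewrite chiL size_prod_XsubC => -[].
have n_gt0 : (0 < #|Omega|)%N.
  rewrite card_gt0; apply: contraTneq VO_gt0 => O0.
  by rewrite /volume O0 big_set0 ltxx.
have l_sorted := eigenvalues_sorted (laplacian (induced G Omega)).
(* Besides the Neumann eigenvalues, the full Laplacian has [1 + b] once and 1 with multiplicity
   [#|B| - 1]. *)
have t_perm : perm_eq t (s ++ (1 + b) :: nseq #|B|.-1 1).
  apply: prod_XsubC_eq; rewrite big_cat big_cons /= -chiP -chiN mulrA.
  rewrite big_nseq iter_mulr_1.
  exact: char_poly_neumann_laplacian.
have s_perm : perm_eq (b :: s) (0 :: [seq a + b | a <- l]).
  apply: prod_XsubC_eq; rewrite !big_cons big_map -chiN -chiLb subr0 mulrC.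
  exact: char_poly_neumann_induced.
have b_ge0 : 0 <= b.
  by rewrite divr_ge0 ?(ltW VO_gt0) // sumr_ge0 // => x _; rewrite ltW ?vm_gt0.
(* [1 - b] is the degree of an interior vertex in the induced graph. *)
have b_le1 : b <= 1.
  have /card_gt0P[y yO] := n_gt0.
  rewrite -subr_ge0 -(Deg_induced G_norm ewE (exist _ y yO)).
  by rewrite /Deg mulr_ge0 ?invr_ge0 ?(ltW (vm_gt0 _ _)) // sumr_ge0 // => z _;
    exact: ew_ge0.
rewrite (sorted_prefixP s_sorted t_sorted t_perm).
have le_1 : (forall x, x \in s -> x <= 1) <-> l`_#|Omega|.-1 + b <= 1.
  by rewrite -size_l; apply: shifted_spectrum_leP l_sorted _ s_perm _ _;
    rewrite ?size_l.
have le_1b : (forall x, x \in s -> x <= 1 + b) <-> l`_#|Omega|.-1 + b <= 1 + b.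
  rewrite -size_l; apply: shifted_spectrum_leP l_sorted _ s_perm _ _;
    rewrite ?size_l //.
    by rewrite addr_ge0.
  by rewrite lerDr.
(* The quotient in (2) is [1 - b], so its bound becomes that of [le_1]; cancelling [b] in [le_1b]
   leaves the bound 1. *)
rewrite /mu /eigval -/l mulrBl divff ?gt_eqF // -/b lerBrDr.
rewrite lerD2r in le_1b.
(* For a single boundary vertex [1 + b] is the only additional eigenvalue; otherwise 1 occurs as
   well and is the least of them. *)
have [m1|m_neq1] := eqVneq #|B| 1%N.
  rewrite m1 /=; split=> [s_le|[_ /(_ erefl)/le_1b s_le] x y xs].
    by split=> // _; apply/le_1b => x xs; apply: s_le; rewrite ?inE.
  by rewrite inE => /eqP ->; exact: s_le.
have m_ge2 : (2 <= #|B|)%N by rewrite ltn_neqAle eq_sym m_neq1.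
split=> [s_le|[/(_ m_ge2)/le_1 s_le _] x y xs].
  split=> [_|/eqP]; last by rewrite (negPf m_neq1).
  apply/le_1 => x xs; apply: s_le => //; rewrite inE mem_nseq eqxx andbT.
  by rewrite -subn1 subn_gt0 m_ge2 orbT.
rewrite inE => /predU1P[->|]; first by rewrite ler_wpDr ?s_le.
by rewrite mem_nseq => /andP[_ /eqP ->]; exact: s_le.
Qed.
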